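(* Let $1\le b\le m$ be integers and let $U=\{u_1\le u_2\le\dots\le u_b\}\subset(0,1)$ be inverse bike speeds with $u_b\le T(m,U)$, where $T(m,U)=1-\frac1m\sum_{j=1}^b(1-u_j)$. Then the algorithm $\mathrm{AllMakeIt}^*$ on input $(m,U)$ solves the Relaxed Bike Sharing problem optimally: the schedule $(X,M)$ it produces is feasible and $\tau(X,M)\le\tau(X',M')$ for every feasible schedule $(X',M')$ (with any number of bikes abandoned).
   Context: There are $m$ agents and $b$ bikes, all starting at the point $0$ of the interval $[0,1]$. Bike $k$ has inverse speed $u_k$; label $0$ denotes walking, with inverse speed $1$. A schedule of size $n$ is a pair $(X,M)$, where $X=(x_1,\dots,x_n)$ satisfies $x_j\ge 0$ and $\sum_j x_j=1$ (consecutive subintervals of $[0,1]$ and their lengths), and $M$ is an $m\times n$ matrix with entries in $\{0,1,\dots,b\}$; $M(i,j)$ is the label of the bike used by agent $i$ on subinterval $x_j$ ($0$ if agent $i$ walks). Let $\widetilde M(i,j)=u_{M(i,j)}$ if $M(i,j)\ne 0$ and $\widetilde M(i,j)=1$ if $M(i,j)=0$. Put $t_{i,j}=\sum_{k=1}^{j}\widetilde M(i,k)x_k$, $t_i=t_{i,n}$, and $\tau(X,M)=\max_i t_i$. $(X,M)$ is feasible if: (1) for $j\ge2$, $M(i,j)\ne0$ implies there is $i'$ with $M(i',j-1)=M(i,j)$; (2) $M(i,j)\ne 0$ implies $M(i',j)\ne M(i,j)$ for all $i'\ne i$; (3) for $j\ge 2$, $M(i,j)=M(i',j-1)\neq0$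 implies $t_{i',j-1}\le t_{i,j-1}$. The Relaxed Bike Sharing problem asks for a feasible schedule minimizing $\tau$; bikes need not be used all the way to the end. Induced partition vector. For a schedule matrix $M$ satisfying (1) and (2), consider the linear program in variables $\tau,x_1,\dots,x_n$: minimize $\tau$ subject to $\tau\ge t_i$ for all $i$; $t_{i',j-1}\le t_{i,j-1}$ whenever $M(i,j)=M(i',j-1)\ne0$, $i\ne i'$; $x_j\ge0$; $\sum_jx_j=1$. An induced partition vector $X_M$ is the $X$-part of an optimal vertex of this program. Standard form. In a schedule $(X,M)$ a zero column is a column $j$ with $x_j=0$; a redundant column is a column $j\geq 2$ of $M$ identical to column $j-1$; a swap-switch is a triple $(i,i',j)$ with $i\ne i'$, $M(i,j)=M(i',j-1)\ne0$ and $t_{i,j-1}=t_{i',j-1}$. The schedule is in standard form if it has none of these. Standardize$(X,M)$ brings a feasible schedule to standard form by deleting zero columns (with their entry of $X$), deleting a redundant column $j$ and merging $x_{j}$ into $x_{j-1}$, and removing a swap-switch $(i,i',j)$ by exchanging rows $i$ and $i'$ of $M$ in columns $j,j+1,\dots,n$. Reduce$(U,M)$: set $X=X_M$; repeat [$(X,M)\leftarrow$ Standardize$(X,M)$; $X\leftarrow X_M$] until $(X,M)$ is in standard form; return $M$. $\mathrm{AllMakeIt}^*(m,U)$. Put $m_k=m-b+k$, $U_k=\{u_1,\dots,u_k\}$. Let $DP[0]$ be the zero column with $m-b$ rows (one column, with no rows if $m=b$). For $k=1,\dots,b$, form a matrix $M$ with $m_k$ rows as the concatenation, left to right, of: for $j=1,\dots,m-b$,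 a single column whose entry in row $i$ is $i-j+1$ if $j\le i\le j+k-1$ and $0$ otherwise; then, for $l=0,\dots,k-1$, a block with as many columns as $DP[l]$, whose rows $1,\dots,m_l$ are $DP[l]$ and whose row $i$, for $m_l<i\le m_k$, has all entries equal to $i-(m-b)$. Set $DP[k]=$ Reduce$(U_k,M)$. The schedule produced is $(X_M,M)$ with $M=DP[b]$. *)

(* Defs.v *)
From Stdlib Require Import Relation_Operators.
From mathcomp Require Import all_boot all_order all_algebra perm.
From mathcomp Require Import reals.

Set Implicit Arguments.
Unset Strict Implicit.
Unset Printing Implicit Defensive.
Import Order.TTheory GRing.Theory Num.Theory.
Local Open Scope ring_scope.

(* Agents (rows) and subintervals (columns) are numbered from 0, bikes are
   labelled 1, ..., b, and label 0 is walking.  [U] lists the inverse speeds of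
   bikes 1, ..., b in this order, so b = size U and U_k is [take k U]. *)

Section Schedules.
Variable R : realType.
Implicit Types (U : seq R) (m n : nat).

(* u_k for k <> 0, and 1 for the walking label 0. *)
Definition inverse_speed U (k : nat) : R := nth 1 (1 :: U) k.

(* t_{i,j}: time at which agent i has completed the first j subintervals.  For
   a 0-based column index [j], [time U X M i j] is thus the time at which
   agent i *starts* column j. *)
Definition time U m n (X : 'rV[R]_n) (M : 'M[nat]_(m, n)) (i : 'I_m) (j : nat)
    : R :=
  \sum_(k < n | (k < j)%N) inverse_speed U (M i k) * X 0 k.

(* Completion times are nonnegative, so the neutral element 0 is harmless
   when there is at least one agent. *)
Definition tau U m n (X : 'rV[R]_n) (M : 'M[nat]_(m, n)) : R :=
  \big[Num.max/0]_(i < m) time U X M i n.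

Definition partition_vector n (X : 'rV[R]_n) : Prop :=
  (forall j, 0 <= X 0 j) /\ \sum_j X 0 j = 1.

Definition labels_in (b : nat) m n (M : 'M[nat]_(m, n)) : Prop :=
  forall i j, (M i j <= b)%N.

Definition bike_present m n (M : 'M[nat]_(m, n)) : Prop :=
  forall (i : 'I_m) (j' j : 'I_n), j = j'.+1 :> nat -> M i j <> 0%N ->
  exists i' : 'I_m, M i' j' = M i j.

Definition bike_exclusive m n (M : 'M[nat]_(m, n)) : Prop :=
  forall (i i' : 'I_m) (j : 'I_n), M i j <> 0%N -> i' <> i -> M i' j <> M i j.

Definition bike_on_time U m n (X : 'rV[R]_n) (M : 'M[nat]_(m, n)) : Prop :=
  forall (i i' : 'I_m) (j' j : 'I_n), j = j'.+1 :> nat ->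
  M i j = M i' j' -> M i j <> 0%N -> time U X M i' j <= time U X M i j.

Definition feasible U m n (X : 'rV[R]_n) (M : 'M[nat]_(m, n)) : Prop :=
  [/\ partition_vector X, labels_in (size U) M,
      bike_present M, bike_exclusive M & bike_on_time U X M].

(* The relaxed problem: bikes may be abandoned anywhere, and the competing
   schedules may have any size. *)
Definition solves_relaxed_bike_sharing U m n (X : 'rV[R]_n)
    (M : 'M[nat]_(m, n)) : Prop :=
  feasible U X M /\
  forall n' (X' : 'rV[R]_n') (M' : 'M[nat]_(m, n')),
    feasible U X' M' -> tau U X M <= tau U X' M'.

(* Points (tau, X) of the feasible polyhedron of the linear program of M. *)
Definition lp_feasible U m n (M : 'M[nat]_(m, n)) (p : R^o * 'rV[R]_n) : Prop :=
  [/\ forall i, time U p.2 M i n <= p.1,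
      forall (i i' : 'I_m) (j' j : 'I_n), j = j'.+1 :> nat -> i <> i' ->
        M i j = M i' j' -> M i j <> 0%N ->
        time U p.2 M i' j <= time U p.2 M i j
    & partition_vector p.2].

(* Vertices of a polyhedron are its extreme points. *)
Definition extreme_point (V : lmodType R) (P : V -> Prop) (p : V) : Prop :=
  P p /\ forall (q r : V) (s : R), P q -> P r -> 0 < s < 1 ->
    p = s *: q + (1 - s) *: r -> q = r.

Definition lp_optimal U m n (M : 'M[nat]_(m, n)) (p : R^o * 'rV[R]_n) : Prop :=
  lp_feasible U M p /\ forall q, lp_feasible U M q -> p.1 <= q.1.

(* X is a possible value of X_M: the optimal vertex need not be unique. *)
Definition induced_partition_vector U m n (M : 'M[nat]_(m, n)) (X : 'rV[R]_n)
    : Prop :=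
  [/\ labels_in (size U) M, bike_present M, bike_exclusive M &
      exists t : R^o, extreme_point (lp_feasible U M) (t, X) /\
                      lp_optimal U M (t, X)].

Definition zero_column n (X : 'rV[R]_n) (j : 'I_n) : Prop := X 0 j = 0.

Definition redundant_column m n (M : 'M[nat]_(m, n)) (j' j : 'I_n) : Prop :=
  j = j'.+1 :> nat /\ forall i, M i j = M i j'.

Definition swap_switch U m n (X : 'rV[R]_n) (M : 'M[nat]_(m, n))
    (i i' : 'I_m) (j : 'I_n) : Prop :=
  [/\ i <> i', time U X M i j = time U X M i' j &
      exists j' : 'I_n, [/\ j = j'.+1 :> nat, M i j = M i' j' & M i j <> 0%N]].

Definition standard_form U m n (X : 'rV[R]_n) (M : 'M[nat]_(m, n)) : Prop :=
  [/\ forall j, ~ zero_column X j,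
      forall j' j, ~ redundant_column M j' j
    & forall i i' j, ~ swap_switch U X M i i' j].

Definition merge_lengths n (X : 'rV[R]_n) (j' j : 'I_n) : 'rV[R]_n.-1 :=
  col' j (\row_k (if k == j' then X 0 j' + X 0 j else X 0 k)).

Definition swap_tails m n (M : 'M[nat]_(m, n)) (i i' : 'I_m) (j : 'I_n)
    : 'M[nat]_(m, n) :=
  \matrix_(a, c) (if (c < j)%N then M a c else M (tperm i i' a) c).

(* Execution states of Reduce; [Running X M] holds the current pair (X, M). *)
Inductive reduce_state (m : nat) : Type :=
| Start n of 'M[nat]_(m, n)
| Running n of 'rV[R]_n & 'M[nat]_(m, n)
| Returned n of 'M[nat]_(m, n).

(* The transitions [std_zero], [std_redundant] and [std_swap] make up
   Standardize, in any order; they are enabled exactly as long as the pair is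
   not in standard form.  Then X is recomputed, and the loop is either left or
   repeated.  All choices (order of the deletions and swaps, optimal vertex)
   are nondeterministic. *)
Inductive reduce_step U m : reduce_state m -> reduce_state m -> Prop :=
| initialize n (M : 'M[nat]_(m, n)) X :
    induced_partition_vector U M X ->
    reduce_step U (Start M) (Running X M)
| std_zero n (X : 'rV[R]_n) (M : 'M[nat]_(m, n)) j :
    zero_column X j ->
    reduce_step U (Running X M) (Running (col' j X) (col' j M))
| std_redundant n (X : 'rV[R]_n) (M : 'M[nat]_(m, n)) j' j :
    redundant_column M j' j ->
    reduce_step U (Running X M) (Running (merge_lengths X j' j) (col' j M))
| std_swap n (X : 'rV[R]_n) (M : 'M[nat]_(m, n)) i i' j :
    swap_switch U X M i i' j ->
    reduce_step U (Running X M) (Running X (swap_tails M i i' j))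
| exit_loop n (X X' : 'rV[R]_n) (M : 'M[nat]_(m, n)) :
    standard_form U X M -> induced_partition_vector U M X' ->
    standard_form U X' M ->
    reduce_step U (Running X M) (Returned M)
| repeat_loop n (X X' : 'rV[R]_n) (M : 'M[nat]_(m, n)) :
    standard_form U X M -> induced_partition_vector U M X' ->
    ~ standard_form U X' M ->
    reduce_step U (Running X M) (Running X' M).

(* Every execution from the state is finite and ends by returning a matrix:
   it neither runs forever nor gets stuck for lack of an X_M. *)
Inductive surely_returns U m : reduce_state m -> Prop :=
| returned n (N : 'M[nat]_(m, n)) : surely_returns U (Returned N)
| returns_later s :
    (exists s', reduce_step U s s') ->
    (forall s', reduce_step U s s' -> surely_returns U s') ->
    surely_returns U s.

End Schedules.

Arguments Start {R m n} _.
Arguments Running {R m n} _ _.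
Arguments Returned {R m n} _.

(* A label matrix with m rows and an arbitrary number of columns. *)
Record label_matrix (m : nat) :=
  LabelMatrix { width : nat; labels :> 'M[nat]_(m, width) }.

Definition lm_cat m (A B : label_matrix m) : label_matrix m :=
  LabelMatrix (row_mx (labels A) (labels B)).

Section AllMakeIt.
Variable R : realType.
Implicit Types (U : seq R) (m b k l : nat).

(* N is a possible value of Reduce(U, M). *)
Definition reduces_to U m (M N : label_matrix m) : Prop :=
  clos_refl_trans _ (@reduce_step R U m) (Start (labels M)) (Returned (labels N)).

Definition shift_columns m b k : label_matrix (m - b + k)%N :=
  LabelMatrix
    (\matrix_(i < (m - b + k)%N, j < (m - b)%N)
       (if (j <= i < j + k)%N then (i - j).+1%N else 0%N)).

(* Rows 1, ..., m_l (those whose index lies in 'I_(m - b + l)) are those of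
   [D]; the 1-based index of the remaining row i is i.+1. *)
Definition dp_block m b k l (D : label_matrix (m - b + l)%N)
    : label_matrix (m - b + k)%N :=
  LabelMatrix
    (\matrix_(i < (m - b + k)%N, c < width D)
       (if (insub (i : nat) : option 'I_(m - b + l)) is Some i'
        then labels D i' c else (i.+1 - (m - b))%N)).

Definition dp_matrix m b k (D : forall l, label_matrix (m - b + l)%N)
    : label_matrix (m - b + k)%N :=
  foldl (fun A l => lm_cat A (dp_block k (D l))) (shift_columns m b k)
        (iota 0 k).

(* D 0, ..., D k are possible values of DP[0], ..., DP[k]; D l is arbitrary
   for l > k. *)
Definition dp_run m b U k (D : forall l, label_matrix (m - b + l)%N) : Prop :=
  D 0%N = LabelMatrix (const_mx 0%N : 'M[nat]_(m - b + 0, 1)) /\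
  forall l, (0 < l <= k)%N -> reduces_to (take l U) (dp_matrix l D) (D l).

(* Whatever choices were made so far, the next call of Reduce returns, and the
   final X_M exists. *)
Definition allmakeit_terminates m b U : Prop :=
  (forall k (D : forall l, label_matrix (m - b + l)%N), (k < b)%N ->
     dp_run U k D ->
     surely_returns (take k.+1 U) (Start (labels (dp_matrix k.+1 D)))) /\
  (forall D : forall l, label_matrix (m - b + l), dp_run U b D ->
     exists X, induced_partition_vector U (labels (D b)) X).

(* (X, M) is a possible output; the cast identifies m - b + b with m. *)
Definition allmakeit_output m b (hbm : (b <= m)%N) U n (X : 'rV[R]_n)
    (M : 'M[nat]_(m, n)) : Prop :=
  exists D : forall l, label_matrix (m - b + l),
    [/\ dp_run U b D,
        LabelMatrix M =
          LabelMatrix (castmx (subnK hbm, erefl (width (D b))) (labels (D b)))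
      & induced_partition_vector U M X].

(* T(m, U) *)
Definition mean_inverse_speed m U : R :=
  1 - m%:R^-1 * \sum_(v <- U) (1 - v).

End AllMakeIt.

(* Main.v *)
Require Import Defs.
From HB Require Import structures.
From Stdlib Require Import Relation_Operators.
From mathcomp Require Import all_boot all_order all_algebra perm.
From mathcomp Require Import boolp reals.
From mathcomp Require Import ring lra zify.

Set Implicit Arguments.
Unset Strict Implicit.
Unset Printing Implicit Defensive.
Import Order.TTheory GRing.Theory Num.Theory.
Local Open Scope ring_scope.

(* Each bike serves at most one agent at a time, so the finishing times of any
   feasible schedule average to at least T(m, U), with equality if every bike
   is in use in every column.  The matrices met by the algorithm are of this
   kind, so it suffices that each of them admits a partition vector with which
   all agents finish at time T; such a vector survives Standardize, and any X_M
   is then one.  For the matrix built from DP[0], ..., DP[k-1], choose the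
   lengths of the shift columns so that the m - b slowest agents meet at their
   end: the savings of agent i are a convolution of the lengths with the
   nonincreasing sequence 1 - u_1, 1 - u_2, ..., so this is a renewal equation
   with a nonnegative solution, which respects the order of the handovers.
   Then the l-th block makes agent m_l + 1, riding bike l + 1, catch up with
   the agents 1, ..., m_l, who start and end the block together at average
   inverse speed T(m_l, U_l) >= u_(l+1). *)

(** * Columns using every bike, and simultaneous arrival *)

Section Balance.
Variable R : realType.
Implicit Types (U : seq R) (m n b : nat).

(** Fullness gives conditions (1) and (2) between any two columns, hence also after deletions, and
    makes the sum of inverse speeds the same in every column. *)
Definition full_column b m (c : 'I_m -> nat) : Prop :=
  [/\ forall i, (c i <= b)%N,
      forall i i', c i <> 0%N -> c i' = c i -> i' = i
    & forall k, (0 < k <= b)%N -> exists i, c i = k].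

Definition full b m n (M : 'M[nat]_(m, n)) : Prop :=
  forall j, full_column b (M^~ j).

Definition balanced U m n (X : 'rV[R]_n) (M : 'M[nat]_(m, n)) : Prop :=
  [/\ partition_vector X, bike_on_time U X M
    & forall i, time U X M i n = mean_inverse_speed m U].

(** The invariant of the algorithm, passed from the matrices handed to Reduce to the DP[l] and back.
    Conditions (1) and (2), absent from [balanced], come from [full]. *)
Definition balanceable U m (A : label_matrix m) : Prop :=
  full (size U) A /\ exists X, balanced U X A.

Lemma full_labels b m n (M : 'M_(m, n)) : full b M -> labels_in b M.
Proof. by move=> fM i j; case: (fM j). Qed.

Lemma full_exclusive b m n (M : 'M_(m, n)) : full b M -> bike_exclusive M.
Proof.
move=> fM i i' j Mij ii' eqM; case: (fM j) => _ inj _.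
exact: ii' (inj _ _ Mij eqM).
Qed.

Lemma full_present b m n (M : 'M_(m, n)) : full b M -> bike_present M.
Proof.
move=> fM i j' j _ /eqP Mij; case: (fM j) => le_b _ _.
by case: (fM j') => _ _; apply; rewrite lt0n Mij le_b.
Qed.

(** The savings are regrouped bike by bike. Keeping the multiplicities serves both the bound for
    exclusive use and the equality for full columns. *)
Lemma sum_savings U m (c : 'I_m -> nat) : (forall i, c i <= size U)%N ->
  \sum_i (1 - inverse_speed U (c i)) =
  \sum_(k < size U) (1 - nth 1 U k) *+ #|[pred i | c i == k.+1]|.
Proof.
move=> le_c.
have saving i : 1 - inverse_speed U (c i) =
    \sum_(k < size U) (1 - nth 1 U k) *+ (c i == k.+1).
  case E: (c i) (le_c i) => [|k] lt_k; first by rewrite subrr big1.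
  rewrite (bigD1 (Ordinal lt_k)) //= eqxx mulr1n big1 ?addr0 // => k' ne_k.
  by rewrite eqSS eq_sym -[k]/(val (Ordinal lt_k)) (inj_eq val_inj) (negPf ne_k).
under eq_bigr do rewrite saving.
rewrite exchange_big /=; apply: eq_bigr => k _.
by rewrite -sumr_const [RHS]big_mkcond; apply: eq_bigr => i _; rewrite mulrb.
Qed.

Lemma mean_inverse_speedE U m : (0 < m)%N ->
  m%:R * mean_inverse_speed m U = m%:R - \sum_(k < size U) (1 - nth 1 U k).
Proof.
move=> m_gt0; rewrite mulrBr mulr1 mulrA divff ?mul1r ?pnatr_eq0 -?lt0n //.
by rewrite (big_nth 1) big_mkord.
Qed.

Lemma sum_column_ge U m (c : 'I_m -> nat) :
    (0 < m)%N -> (forall k, inverse_speed U k <= 1) ->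
    (forall i, c i <= size U)%N ->
    (forall i i', c i <> 0%N -> c i' = c i -> i' = i) ->
  m%:R * mean_inverse_speed m U <= \sum_i inverse_speed U (c i).
Proof.
move=> m_gt0 U1 le_c inj_c; rewrite mean_inverse_speedE // lerBlDl -lerBlDr.
rewrite -[X in X%:R](card_ord m) -sumr_const -sumrB sum_savings //.
apply: ler_sum => k _; have : (#|[pred i | c i == k.+1]| <= 1)%N.
  apply/card_le1_eqP => i i'; rewrite !inE => /eqP ci /eqP ci'.
  by apply: inj_c; rewrite ?ci ?ci'.
by case: #|_| => [|[|//]] _; rewrite ?mulr0n ?subr_ge0 ?(U1 k.+1).
Qed.

Lemma sum_full_column U m (c : 'I_m -> nat) :
    (0 < m)%N -> full_column (size U) c ->
  \sum_i inverse_speed U (c i) = m%:R * mean_inverse_speed m U.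
Proof.
move=> m_gt0 [le_c inj_c sur_c]; rewrite mean_inverse_speedE //.
apply/eqP; rewrite eq_sym subr_eq addrC -subr_eq.
rewrite -[X in X%:R](card_ord m) -sumr_const -sumrB sum_savings //.
apply/eqP/eq_bigr => k _; have [|i ci] := sur_c k.+1; first by rewrite ltn_ord.
rewrite -[RHS]mulr1n; congr (_ *+ _); rewrite -(card1 i); apply: eq_card => i'.
rewrite !inE; apply/eqP/eqP => [ci'|-> //].
by apply: inj_c; rewrite ci.
Qed.

Lemma time_linear U m n (M : 'M[nat]_(m, n)) i j : scalar (fun X => time U X M i j).
Proof.
move=> a X Y; rewrite /time mulr_sumr -big_split; apply: eq_bigr => k _ /=.
by rewrite !mxE mulrDr mulrCA.
Qed.

Lemma timeZ U m n (M : 'M[nat]_(m, n)) i j a X :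
  time U (a *: X) M i j = a * time U X M i j.
Proof.
by rewrite /time mulr_sumr; apply: eq_bigr => k _; rewrite !mxE mulrCA.
Qed.

Lemma sum_time U m n (X : 'rV_n) (M : 'M[nat]_(m, n)) :
  \sum_i time U X M i n = \sum_j (\sum_i inverse_speed U (M i j)) * X 0 j.
Proof.
rewrite /time; under eq_bigr => i _ do
  under eq_bigl => k do rewrite ltn_ord.
by rewrite exchange_big; apply: eq_bigr => k _; rewrite mulr_suml.
Qed.

Lemma sum_time_ge U m n (X : 'rV_n) (M : 'M[nat]_(m, n)) :
    (0 < m)%N -> (forall k, inverse_speed U k <= 1) ->
    partition_vector X -> labels_in (size U) M -> bike_exclusive M ->
  m%:R * mean_inverse_speed m U <= \sum_i time U X M i n.
Proof.
move=> m_gt0 U1 [X0 X1] lM eM; rewrite sum_time -[leLHS]mulr1 -[X in _ * X <= _]X1 mulr_sumr.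
apply: ler_sum => j _; apply: ler_wpM2r => //.
apply: (@sum_column_ge U m (M^~ j)) => // i i' Mi eqM.
by apply: contrapT => /(eM _ _ _ Mi).
Qed.

Lemma sum_time_full U m n (X : 'rV_n) (M : 'M[nat]_(m, n)) :
    (0 < m)%N -> full (size U) M ->
  \sum_i time U X M i n = m%:R * mean_inverse_speed m U * \sum_j X 0 j.
Proof.
move=> m_gt0 fM; rewrite sum_time mulr_sumr.
by apply: eq_bigr => j _; rewrite (sum_full_column m_gt0 (fM j)).
Qed.

(* The times average to T, so they are all T as soon as none exceeds it. *)
Lemma balanced_of_le U m n (X : 'rV_n) (M : 'M[nat]_(m, n)) :
    (0 < m)%N -> full (size U) M -> partition_vector X -> bike_on_time U X M ->
    (forall i, time U X M i n <= mean_inverse_speed m U) ->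
  balanced U X M.
Proof.
move=> m_gt0 fM pX oX le_T; split=> // i; apply/eqP.
have: \sum_i (mean_inverse_speed m U - time U X M i n) == 0.
  by rewrite sumrB sum_time_full // (proj2 pX) mulr1 sumr_const card_ord mulr_natl subrr.
rewrite psumr_eq0; last by move=> i' _; rewrite subr_ge0.
by move=> /allP/(_ i); rewrite mem_index_enum subr_eq0 eq_sym; apply.
Qed.

(** The finishing times of any competitor average to at least T, so the largest one is at least T,
    the common finishing time here. *)
Lemma balanced_optimal U m n (X : 'rV_n) (M : 'M[nat]_(m, n)) :
    (0 < m)%N -> (forall k, 0 <= inverse_speed U k <= 1) ->
    full (size U) M -> balanced U X M ->
  solves_relaxed_bike_sharing U X M.
Proof.
move=> m_gt0 U01 fM [pX oX eT]; split.
  split=> //; [exact: full_labels|exact: full_present|exact: full_exclusive].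
have m_gt0R : 0 < m%:R :> R by rewrite ltr0n.
(* [tau] takes the maximum together with 0, so T has to be nonnegative. *)
have T_ge0 : 0 <= mean_inverse_speed m U.
  rewrite -(eT (Ordinal m_gt0)); apply: sumr_ge0 => k _; apply: mulr_ge0.
    by case/andP: (U01 (M (Ordinal m_gt0) k)).
  by case: pX.
move=> n' X' M' [pX' lM' _ eM' _].
apply: (@le_trans _ _ (mean_inverse_speed m U)).
  by apply: (big_ind (fun x => x <= _)) => [//|x y xT yT|i _]; rewrite ?ge_max ?xT ?eT.
rewrite -(ler_pM2l m_gt0R); apply: (le_trans (sum_time_ge _ _ pX' lM' eM')) => //.
  by move=> k; case/andP: (U01 k).
rewrite mulr_natl -[X in _ *+ X](card_ord m) -sumr_const.
by apply: ler_sum => i _; rewrite /tau le_bigmax.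
Qed.

End Balance.

(** * Optimal vertices of the linear program *)

Section Vertices.
Variable R : realType.

(* While x is not extreme, move it along a segment of the polyhedron through it
   until one more constraint becomes tight. *)
Lemma extreme_point_exists (V : lmodType R) (C : finType)
    (f : C -> {scalar V}) (E : V -> Prop) :
    (forall x q r (a : R), E x -> E q -> E r -> E (x + a *: (q - r))) ->
    (forall q r, E q -> E r -> q <> r -> exists c, f c (q - r) < 0) ->
    (exists x, E x /\ forall c, 0 <= f c x) ->
  exists x, extreme_point (fun y => E y /\ forall c, 0 <= f c y) x.
Proof.
move=> affE pointed [x [Ex fx]].
have [n] := ubnP #|[pred c | f c x != 0]|.
elim: n x Ex fx => // n IHn x Ex fx lt_n.
have [[_ ext]|] := pselect (extreme_point (fun y => E y /\ forall c, 0 <= f c y) x).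
  by exists x.
move=> not_ext; suff [q [r [s [[Eq fq] [Er fr] /andP[s0 s1] xE /pointed]]]] :
    exists q r s, [/\ E q /\ forall c, 0 <= f c q, E r /\ forall c, 0 <= f c r,
      0 < s < 1, x = s *: q + (1 - s) *: r & q <> r].
  case=> // c0 fc0.
  pose d := q - r.
  (* x lies strictly between q and r, so a constraint tight at x is tight at both and stays tight
     along d. *)
  have tight c : f c x = 0 -> f c d = 0.
    move=> fcx; have: f c x = s * f c q + (1 - s) * f c r by rewrite xE linearP /= linearZ.
    rewrite fcx linearB => /esym/eqP.
    have := fq c; have := fr c.
    by rewrite paddr_eq0 ?mulr_ge0 ?subr_ge0 ?(ltW s0) ?(ltW s1) // !mulf_eq0 (gt_eqF s0)
      subr_eq0 (gt_eqF s1) => _ _ /= /andP[/eqP-> /eqP->]; rewrite subrr.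
  (* Ratio test: c1 is a first constraint to become tight on the way from x along d. *)
  have [c1 fc1 min_c1] := arg_minP (fun c => f c x / - f c d) (fc0 : [pred c | f c d < 0] c0).
  pose a := f c1 x / - f c1 d.
  have a_ge0 : 0 <= a by rewrite divr_ge0 ?fx ?oppr_ge0 ?ltW.
  have fxa c : f c (x + a *: d) = f c x + a * f c d by rewrite linearD linearZ.
  apply: (IHn (x + a *: d)); first exact: affE.
    move=> c; rewrite fxa; have [fcd|fcd] := ltP (f c d) 0; last first.
      by apply: addr_ge0 (fx c) (mulr_ge0 a_ge0 fcd).
    by rewrite -[f c d]opprK mulrN subr_ge0 -ler_pdivlMr ?oppr_gt0 // min_c1.
  rewrite ltnS in lt_n; apply: leq_trans lt_n; apply: proper_card.
  apply/properP; split.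
    apply/subsetP => c; rewrite !inE fxa; apply: contra => /eqP fcx.
    by rewrite fcx tight // mulr0 addr0.
  exists c1; rewrite !inE ?fxa.
    by apply/eqP => /tight fc1'; rewrite /= fc1' ltxx in fc1.
  by rewrite -[f c1 d]opprK mulrN divfK ?subrr ?eqxx // oppr_eq0 (ltr0_neq0 fc1).
apply: contrapT => none; apply: not_ext; split=> // q r s Pq Pr s01 xE.
by apply: contrapT => qr; apply: none; exists q, r, s.
Qed.

End Vertices.

(** * Induced partition vectors when simultaneous arrival is possible *)

Section InducedPartitions.
Variables (R : realType) (U : seq R) (m : nat).
Hypothesis m_gt0 : (0 < m)%N.
Let T := mean_inverse_speed m U.

Lemma lp_feasible_balanced n (X : 'rV[R]_n) (M : 'M[nat]_(m, n)) :
  full (size U) M -> lp_feasible U M (T, X) -> balanced U X M.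
Proof.
move=> fM [/= le_T oX pX]; apply: balanced_of_le => // i i' j' j jj' eqM Mij.
by have [->//|/eqP ii'] := eqVneq i i'; apply: oX eqM Mij.
Qed.

Lemma balanced_lp_feasible n (X : 'rV[R]_n) (M : 'M[nat]_(m, n)) :
  balanced U X M -> lp_feasible U M (T, X).
Proof.
case=> pX oX eT; split=> //= [i|i i' j' j jj' _ eqM Mij]; first by rewrite eT.
exact: oX eqM Mij.
Qed.

Lemma lp_feasible_ge n (p : R^o * 'rV[R]_n) (M : 'M[nat]_(m, n)) :
  full (size U) M -> lp_feasible U M p -> T <= p.1.
Proof.
move=> fM [le_p _ [_ X1]].
rewrite -(ler_pM2l (_ : 0 < m%:R)) ?ltr0n // -[leLHS]mulr1 -[X in _ * X <= _]X1.
rewrite -(sum_time_full _ m_gt0 fM) mulr_natl -[X in _ *+ X](card_ord m) -sumr_const.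
by apply: ler_sum => i _; apply: le_p.
Qed.

(** One balanced vector brings the minimum down to its lower bound T, so every optimal X has all
    times at most T, hence equal to T. *)
Lemma induced_balanced n (X : 'rV[R]_n) (M : 'M[nat]_(m, n)) :
    full (size U) M -> (exists Y, balanced U Y M) ->
  induced_partition_vector U M X -> balanced U X M.
Proof.
move=> fM [Y bY] [_ _ _ [t [_ [ft opt]]]].
suff tT : t = T by apply: lp_feasible_balanced; rewrite -?tT.
by apply/le_anti; rewrite (lp_feasible_ge fM ft) (opt _ (balanced_lp_feasible bY)).
Qed.

(** The balanced vectors form the face [tau = T] of the polyhedron, so an extreme point among them
    is a vertex of the whole program. *)
Lemma induced_exists n (M : 'M[nat]_(m, n)) :
    full (size U) M -> (exists Y, balanced U Y M) ->
  exists X, induced_partition_vector U M X.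
Proof.
move=> fM [Y bY].
pose V : lmodType R := 'rV[R]_n.
pose E (X : V) := \sum_j X 0 j = 1 /\ forall i, time U X M i n = T.
(* One constraint per length and per possible handover; a quadruple that is no handover gets the
   zero form. *)
pose C : finType := ('I_n + 'I_m * 'I_m * 'I_n * 'I_n)%type.
pose g (c : C) (X : V) : R := match c with
  | inl j => X 0 j
  | inr (i, i', j', j) =>
      if [&& j == j'.+1 :> nat, M i j == M i' j' & M i j != 0%N]
      then time U X M i j - time U X M i' j else 0
  end.
have g_lin c : scalar (g c).
  move=> a X Z; case: c => [j|[[[i i'] j'] j]] /=; first by rewrite !mxE.
  case: ifP => _; last by rewrite mulr0 addr0.
  by rewrite !(time_linear _ _ _ _ a) mulrBr opprD addrACA.
pose f c : {scalar V} := HB.pack (g c) (GRing.isLinear.Build _ _ _ _ _ (g_lin c)).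
have EfP (X : V) : (E X /\ forall c, 0 <= f c X) <-> balanced U X M.
  split=> [[[X1 eT] f0]|[[X0 X1] oX eT]].
    split=> //; first by split=> // j; apply: (f0 (inl j)).
    move=> i i' j' j jj' eqM /eqP Mij.
    have : 0 <= g (inr (i, i', j', j)) X := f0 _.
    by rewrite /g jj' -eqM Mij !eqxx subr_ge0.
  split=> // c; change (0 <= g c X).
  case: c => [j|[[[i i'] j'] j]]; first exact: X0.
  rewrite /g; case: ifP => // /and3P[/eqP jj' /eqP eqM /eqP Mij].
  by rewrite subr_ge0; apply: oX eqM Mij.
have [X [/EfP bX ext]] : exists X, extreme_point (fun X => E X /\ forall c, 0 <= f c X) X.
  apply: extreme_point_exists; last by exists Y; apply/EfP.
    move=> x q r a [x1 xT] [q1 qT] [r1 rT]; split.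
      have <- : \sum_j x 0 j + a * (\sum_j q 0 j - \sum_j r 0 j) = 1.
        by rewrite x1 q1 r1 subrr mulr0 addr0.
      by rewrite -sumrB mulr_sumr -big_split; apply: eq_bigr => j _; rewrite !mxE.
    move=> i; have tl b (v w : V) : time U (b *: v + w) M i n = b * time U v M i n + time U w M i n.
      exact: time_linear.
    by rewrite [x + _]addrC tl xT -scaleN1r [q + _]addrC tl rT qT mulN1r addNr mulr0 add0r.
  move=> q r [q1 _] [r1 _] qr; apply: contrapT => none; apply: qr.
  (* If no coordinate of q - r is negative, all of them vanish, since their sum is 0. *)
  have ge0 j : 0 <= q 0 j - r 0 j.
    rewrite leNgt; apply/negP => lt0; apply: none; exists (inl j).
    by rewrite /f /= !mxE.
  have: \sum_j (q 0 j - r 0 j) == 0 by rewrite sumrB q1 r1 subrr.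
  rewrite psumr_eq0 // => /allP z; apply/rowP => j; apply/eqP.
  by rewrite -subr_eq0; apply: (implyP (z j (mem_index_enum j))).
exists X; split; [exact: full_labels|exact: full_present|exact: full_exclusive|].
have fT := balanced_lp_feasible bX.
exists T; split; last by split=> // q; apply: lp_feasible_ge.
split=> // -[tq q] [tr r] s fq fr s01 [tE XE].
have leq := lp_feasible_ge fM fq; have ler := lp_feasible_ge fM fr; rewrite /= in leq ler.
have /andP[s0 s1] := s01.
(* Both objective values are at least T, and a proper convex combination of them is T. *)
have tqE : tq = T by move: tE; rewrite /GRing.scale /=; nra.
have trE : tr = T by move: tE; rewrite /GRing.scale /=; nra.
rewrite tqE trE in fq fr *; congr pair; apply: (ext q r s) => //.
  exact/EfP/lp_feasible_balanced.
exact/EfP/lp_feasible_balanced.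
Qed.

End InducedPartitions.

(** * Reduce *)

Section Reduce.
Variables (R : realType) (U : seq R) (m : nat).

Lemma full_col' b n (M : 'M[nat]_(m, n)) j : full b M -> full b (col' j M).
Proof.
move=> fM k; have [le_b inj sur] := fM (lift j k); split=> [i|i i'|l l_b].
- by rewrite mxE.
- by rewrite !mxE; apply: inj.
- by have [i Mi] := sur l l_b; exists i; rewrite mxE.
Qed.

Lemma full_swap_tails b n (M : 'M[nat]_(m, n)) i i' j :
  full b M -> full b (swap_tails M i i' j).
Proof.
move=> fM c; have [le_b inj sur] := fM c; split=> [a|a a'|l l_b].
- by rewrite mxE; case: ifP.
- rewrite !mxE; case: ifP => _; first exact: inj.
  by move=> Ma eqM; apply/(@perm_inj _ (tperm i i'))/inj.
- have [a Ma] := sur l l_b; exists (if (c < j)%N then a else tperm i i' a).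
  by rewrite mxE; case: (c < j)%N; rewrite ?tpermK.
Qed.

(** For c >= j the index [bump j c] moves past the deleted column, which takes no time. *)
Lemma time_col' n (X : 'rV[R]_n) (M : 'M[nat]_(m, n)) j i c : X 0 j = 0 ->
  time U (col' j X) (col' j M) i c = time U X M i (bump j c).
Proof.
case: n X M j => [|n] X M j; first by case: j.
move=> Xj; rewrite /time [RHS]big_mkcond (bigD1_ord j) //= Xj mulr0 if_same add0r.
rewrite [LHS]big_mkcond; apply: eq_bigr => k _; rewrite !mxE.
by rewrite !ltnNge leq_bump2.
Qed.

Lemma time_succ n (X : 'rV[R]_n) (M : 'M[nat]_(m, n)) i (j : 'I_n) :
  time U X M i j.+1 = time U X M i j + inverse_speed U (M i j) * X 0 j.
Proof.
rewrite /time (bigD1 j) //= addrC; congr (_ + _); apply: eq_bigl => k.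
by rewrite ltnS ltn_neqAle andbC.
Qed.

(** The only new handovers lead from column j - 1 straight to column j + 1. *)
Lemma balanced_zero n (X : 'rV[R]_n) (M : 'M[nat]_(m, n)) j :
    full (size U) M -> X 0 j = 0 -> balanced U X M ->
  balanced U (col' j X) (col' j M).
Proof.
case: n X M j => [|n] X M j; first by case: j.
move=> fM Xj [[X0 X1] oX eT]; split.
- split=> [k|]; first by rewrite mxE.
  rewrite -[RHS]X1 [RHS](bigD1_ord j) //= Xj add0r.
  by apply: eq_bigr => k _; rewrite mxE.
- move=> i i' k' k kk'; rewrite !mxE !time_col' // => eqM Mik.
  have [le_jk'|lt_k'j] := leqP j k'.
    by apply: oX eqM Mik; rewrite /= kk' /bump le_jk' leqW.
  have [eq_jk|ne_jk] := eqVneq (j : nat) k; last first.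
    have lt_kj : (k < j)%N by rewrite ltn_neqAle eq_sym ne_jk kk'.
    by apply: oX eqM Mik; rewrite /= kk' /bump -kk' ![(j <= _)%N]leqNgt lt_k'j lt_kj.
  (* By fullness some agent rides this bike in the zero column. The two handovers through this agent
     are chained, as no time passes in column j. *)
  have [i1 Mi1] : exists i1, M i1 j = M i (lift j k).
    case: (fM j) => _ _; apply; rewrite lt0n; move/eqP: Mik => ->.
    by case: (fM (lift j k)) => ->.
  have tj i2 : time U X M i2 k.+1 = time U X M i2 k.
    by rewrite -eq_jk time_succ Xj mulr0 addr0.
  rewrite /bump -eq_jk leqnn add1n eq_jk tj.
  apply: (@le_trans _ _ (time U X M i1 j)).
    rewrite -eq_jk; apply: (oX i1 i' (lift j k') j).
    - by rewrite /= /bump leqNgt lt_k'j eq_jk kk'.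
    - by rewrite Mi1.
    - by rewrite Mi1.
  rewrite eq_jk -tj.
  have lkE : lift j k = k.+1 :> nat by rewrite /= /bump eq_jk leqnn.
  rewrite -lkE; apply: (oX i i1 j (lift j k)) => //.
  by rewrite lkE eq_jk.
- by move=> i; rewrite time_col' // /bump -ltnS ltn_ord eT.
Qed.

(* Merging x_j into x_j' amounts to moving the length x_j to column j' and then
   deleting the zero column j. *)
Lemma balanced_redundant n (X : 'rV[R]_n) (M : 'M[nat]_(m, n)) j' j :
    full (size U) M -> redundant_column M j' j -> balanced U X M ->
  balanced U (merge_lengths X j' j) (col' j M).
Proof.
move=> fM [jj' eqM] [[X0 X1] oX eT].
have ne_jj' : j != j' by rewrite -(inj_eq val_inj) /= jj' gtn_eqF.
pose Y : 'rV[R]_n :=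
  \row_k if k == j' then X 0 j' + X 0 j else if k == j then 0 else X 0 k.
have -> : merge_lengths X j' j = col' j Y.
  apply/rowP => k; rewrite !mxE; case: ifP => // _.
  by rewrite eq_sym (negPf (neq_lift j k)).
have YE : Y = X 0 j *: (delta_mx 0 j' - delta_mx 0 j) + X.
  apply/rowP => k; rewrite !mxE /=; have [->|_] := eqVneq k j'.
    by rewrite eq_sym (negPf ne_jj') /= subr0 mulr1 addrC.
  by have [->|_] := eqVneq k j;
    rewrite /= ?mulr0n ?mulr1n ?sub0r ?oppr0 ?mulrN1 ?mulr0 ?addNr ?add0r.
have td a k c : time U (delta_mx 0 k) M a c =
    if (k < c)%N then inverse_speed U (M a k) else 0.
  rewrite /time big_mkcond (bigD1 k) //= mxE !eqxx mulr1 big1 ?addr0 // => l lk.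
  by rewrite mxE (negPf lk) andbF mulr0 if_same.
(* Columns j' and j carry the same labels, so moving length between them alters only the times at
   the start of column j. *)
have tY a c : c <> j :> nat -> time U Y M a c = time U X M a c.
  move=> cj; rewrite YE time_linear -scaleN1r [_ + -1 *: _]addrC time_linear !td eqM.
  suff -> : (j' < c)%N = (j < c)%N
    by case: ifP => _; rewrite mulN1r ?oppr0 ?add0r ?addNr mulr0 add0r.
  by rewrite [RHS]ltn_neqAle -jj' eq_sym; case: eqP cj.
have Yj : Y 0 j = 0 by rewrite mxE eqxx (negPf ne_jj').
apply: balanced_zero => //; split.
- split=> [k|].
    by rewrite mxE; case: ifP => _; [rewrite addr_ge0|case: ifP].
  have sum_delta k0 : \sum_k (delta_mx 0 k0 : 'rV[R]_n) 0 k = 1.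
    by rewrite (bigD1 k0) //= mxE !eqxx big1 ?addr0 // => k /negPf nk; rewrite mxE nk andbF.
  transitivity (X 0 j * (\sum_k (delta_mx 0 j' : 'rV[R]_n) 0 k
      - \sum_k (delta_mx 0 j : 'rV[R]_n) 0 k) + \sum_k X 0 k).
    rewrite YE -sumrB mulr_sumr -big_split.
    by apply: eq_bigr => k _; rewrite !mxE.
  by rewrite !sum_delta subrr mulr0 add0r.
(* At the start of column j, where times may have changed, every bike stays with its agent. *)
- move=> i i' k' k kk' eqMk Mk; have [kj|kj] := eqVneq (k : nat) j.
    have ek : k = j by apply: val_inj.
    have ek' : k' = j' by apply: val_inj; apply: succn_inj; rewrite -kk' -jj'.
    suff -> : i' = i by [].
    case: (fM j) => _ inj _; apply: inj; first by rewrite -ek.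
    by rewrite -[in RHS]ek eqMk ek' eqM.
  by rewrite !tY; try (by apply/eqP); apply: oX eqMk Mk.
- by move=> i; rewrite tY //; apply/eqP; rewrite gtn_eqF.
Qed.

(** Both agents start column j at the same time, so exchanging the tails merely permutes the times
    from there on; at j itself the old and the permuted times agree, which settles the handovers
    into column j. *)
Lemma balanced_swap n (X : 'rV[R]_n) (M : 'M[nat]_(m, n)) i i' (j : 'I_n) :
    time U X M i j = time U X M i' j -> balanced U X M ->
  balanced U X (swap_tails M i i' j).
Proof.
move=> tij [pX oX eT]; set p := tperm i i'.
have tp a : time U X M (p a) j = time U X M a j.
  by rewrite /p; case: tpermP => [->|->|].
have split_time (N : 'M[nat]_(m, n)) a c : (j <= c)%N -> time U X N a c =
    time U X N a j + \sum_(k < n | (k < c)%N && ~~ (k < j)%N) inverse_speed U (N a k) * X 0 k.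
  move=> jc; rewrite {1}/time (bigID (fun k : 'I_n => (k < j)%N)) /=; congr (_ + _).
  by apply: eq_bigl => k; rewrite andb_idl // => /leq_trans; apply.
have t_le a c : (c <= j)%N -> time U X (swap_tails M i i' j) a c = time U X M a c.
  by move=> cj; apply: eq_bigr => k kc; rewrite mxE (leq_trans kc cj).
have t_ge a c : (j <= c)%N -> time U X (swap_tails M i i' j) a c = time U X M (p a) c.
  move=> jc; rewrite (split_time _ a c) // (split_time _ (p a) c) // t_le // tp; congr (_ + _).
  by apply: eq_bigr => k /andP[_ kj]; rewrite mxE (negPf kj).
split=> // [a a' c' c cc'|a]; last by rewrite t_ge ?eT // ltnW.
rewrite !mxE; have [cj|jc] := ltnP c j.
  have c'j : (c' < j)%N by rewrite -cc' ltnW.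
  by rewrite c'j !t_le 1?ltnW //; apply: oX.
rewrite (t_ge a) //; have [c'j|jc'] := ltnP c' j.
  have -> : (c : nat) = j by apply/eqP; rewrite eqn_leq jc cc' c'j.
  have jE : j = c by apply: val_inj; apply/eqP; rewrite /= eqn_leq jc cc' c'j.
  by rewrite t_le // jE; apply: oX.
by rewrite t_ge // => eqM Mc; apply: oX eqM Mc.
Qed.

(** Termination measure for swaps, which keep the width. The middle sum has at most one term, and
    none for the last column. *)
Definition changes n (M : 'M[nat]_(m, n)) : nat :=
  \sum_(j' < n) \sum_(j < n | j == j'.+1 :> nat) \sum_i (M i j != M i j').

(** Past column j only rows are permuted, so the other boundaries keep their counts. At the boundary
    before j, rows i and i' both changed label; after the swap row i' keeps its bike. *)
Lemma changes_swap_tails n (X : 'rV[R]_n) (M : 'M[nat]_(m, n)) i i' j :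
  full (size U) M -> swap_switch U X M i i' j ->
  (changes (swap_tails M i i' j) < changes M)%N.
Proof.
move=> fM [ii' _ [j' [jj' eqM Mij]]].
have ltn_sum1 (I : finType) (P : pred I) (i0 : I) (F G : I -> nat) :
    P i0 -> (forall k, P k -> F k <= G k)%N -> (F i0 < G i0)%N ->
    (\sum_(k | P k) F k < \sum_(k | P k) G k)%N.
  move=> Pi0 FG lt0; rewrite (bigD1 i0) //= [ltnRHS](bigD1 i0) //= -addSn.
  by rewrite leq_add // leq_sum // => k /andP[/FG].
have le_a k a : k = j ->
    ((swap_tails M i i' j a k != swap_tails M i i' j a j') <= (M a k != M a j'))%N.
  move=> ->; rewrite !mxE ltnn jj' ltnSn.
  case: tpermP => [->|->|//]; last by rewrite eqM eqxx.
  suff -> : M i j != M i j' by apply: leq_b1.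
  rewrite eqM; apply/eqP => eq_i; case: (fM j') => _ inj _.
  by apply/ii'/inj; rewrite -?eq_i -?eqM.
have le_col (k' k : 'I_n) : k = k'.+1 :> nat ->
    (\sum_a (swap_tails M i i' j a k != swap_tails M i i' j a k') <=
     \sum_a (M a k != M a k'))%N.
  move=> kk'; have [kj|jk|kj] := ltngtP k j.
  - have k'j : (k' < j)%N by apply: ltn_trans kj; rewrite kk'.
    by apply: leq_sum => a _; rewrite !mxE kj k'j.
  - have k'j : (k' < j)%N = false by apply/negbTE; rewrite -leqNgt -ltnS -kk'.
    rewrite [leqRHS](reindex_inj (@perm_inj _ (tperm i i'))).
    by apply: leq_sum => a _; rewrite !mxE k'j ltnNge (ltnW jk).
  - have ek' : k' = j' by apply: val_inj; apply: succn_inj; rewrite -kk' -jj'.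
    by apply: leq_sum => a _; rewrite ek'; apply/le_a/val_inj.
apply: (ltn_sum1 _ _ j') => // [k' _|]; first by apply: leq_sum => k /eqP; apply: le_col.
apply: (ltn_sum1 _ _ j) => [|k /eqP|]; [exact/eqP|exact: le_col|].
apply: (ltn_sum1 _ _ i') => // [a _|]; first exact: le_a.
rewrite !mxE ltnn jj' ltnSn tpermR eqM eqxx -eqM lt0b.
apply/eqP => eq_i'; case: (fM j) => _ inj _.
by apply/ii'/esym/inj; rewrite ?eqM // -eqM.
Qed.

Hypothesis m_gt0 : (0 < m)%N.

Definition balanced_state (s : reduce_state R m) : Prop :=
  match s with
  | Start n M => full (size U) M /\ exists X, balanced U X M
  | Running n X M => full (size U) M /\ balanced U X M
  | Returned n M => full (size U) M /\ exists X, balanced U X M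
  end.

Lemma balanced_step s s' :
  reduce_step U s s' -> balanced_state s -> balanced_state s'.
Proof.
case=> {s s'} [n M X ind|n X M j Xj|n X M j' j red|n X M i i' j [_ tij _]
  |n X X' M _ _ _|n X X' M _ ind _] [fM bX].
- by split=> //; apply: induced_balanced ind.
- by split; [apply: full_col'|apply: balanced_zero].
- by split; [apply: full_col'|apply: balanced_redundant].
- by split; [apply: full_swap_tails|apply: balanced_swap].
- by split=> //; exists X.
- by split=> //; apply: induced_balanced ind => //; exists X.
Qed.

Lemma standardize_enabled n (X : 'rV[R]_n) (M : 'M[nat]_(m, n)) :
  ~ standard_form U X M -> exists s, reduce_step U (Running X M) s.
Proof.
move=> nsf; apply: contrapT => stuck; apply: nsf.
split=> [j z|j' j r|i i' j sw]; apply: stuck.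
- by eexists; apply: std_zero z.
- by eexists; apply: std_redundant r.
- by eexists; apply: std_swap sw.
Qed.

(** Sorts the successors by what decreases: the width under deletions, [changes] under swaps.
    Recomputing X lowers neither, so that case records the loss of standard form instead. *)
Lemma reduce_step_inv s s' : reduce_step U s s' -> balanced_state s ->
  match s with
  | Start n M => exists X : 'rV_n, s' = Running X M
  | Running n X M =>
      [\/ exists n' (Y : 'rV_n') N, s' = Running Y N /\ (n' < n)%N,
          exists N, s' = Running X N /\ (changes N < changes M)%N,
          exists N : 'M_(m, n), s' = Returned N
        | exists X', [/\ s' = Running X' M, standard_form U X M
                        & ~ standard_form U X' M]]
  | Returned n M => False
  end.
Proof.
have pred_lt n (j : 'I_n) : (n.-1 < n)%N.
  by rewrite prednK // (leq_ltn_trans _ (ltn_ord j)).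
case=> {s s'} [n M X _|n X M j _|n X M j' j _|n X M i i' j sw
  |n X X' M _ _ _|n X X' M sf _ nsf] [fM _].
- by exists X.
- by apply: Or41; do 3!eexists; split; last exact: pred_lt j.
- by apply: Or41; do 3!eexists; split; last exact: pred_lt j.
- by apply: Or42; eexists; split; last exact: changes_swap_tails fM sw.
- by apply: Or43; exists M.
- by apply: Or44; exists X'.
Qed.

(* The width and, at constant width, the number of label changes decrease,
   except when an X_M is recomputed, which never happens twice in a row. *)
Lemma running_returns n (X : 'rV[R]_n) (M : 'M[nat]_(m, n)) :
  balanced_state (Running X M) -> surely_returns U (Running X M).
Proof.
have [k] := ubnP n; elim: k n X M => // k IHk n X M; rewrite ltnS => le_nk.
have [c] := ubnP (changes M); elim: c X M => // c IHc X M; rewrite ltnS => le_c.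
(* A pair not in standard form admits no recomputation, so its steps lower a measure. Y is arbitrary
   because recomputation replaces X but keeps M. *)
have nonstd (Y : 'rV[R]_n) : balanced_state (Running Y M) ->
    ~ standard_form U Y M -> surely_returns U (Running Y M).
  move=> bY nsf; apply: returns_later; first exact: standardize_enabled.
  move=> s' st; have bs' := balanced_step st bY.
  have [[n' [Z [N [Es' lt_n]]]]|[N [Es' lt_c]]|[N ->]|[X' [_ /nsf //]]] :=
    reduce_step_inv st bY.
  - by rewrite Es' in bs' *; apply: IHk bs'; apply: leq_trans le_nk.
  - by rewrite Es' in bs' *; apply: IHc bs'; apply: leq_trans le_c.
  - exact: returned.
move=> bX; have [sf|nsf] := pselect (standard_form U X M); last exact: nonstd.
apply: returns_later => [|s' st].
  have [fM bXM] := bX; have [X' ind] := induced_exists m_gt0 fM (ex_intro _ X bXM).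
  have [sf'|nsf'] := pselect (standard_form U X' M).
    by eexists; apply: exit_loop ind sf'.
  by eexists; apply: repeat_loop ind nsf'.
have bs' := balanced_step st bX.
have [[n' [Z [N [Es' lt_n]]]]|[N [Es' lt_c]]|[N ->]|[X' [Es' _ nsf']]] :=
  reduce_step_inv st bX.
- by rewrite Es' in bs' *; apply: IHk bs'; apply: leq_trans le_nk.
- by rewrite Es' in bs' *; apply: IHc bs'; apply: leq_trans le_c.
- exact: returned.
- by rewrite Es' in bs' *; apply: nonstd.
Qed.

Lemma reduce_surely_returns (A : label_matrix m) :
  balanceable U A -> surely_returns U (Start (labels A)).
Proof.
move=> bA; apply: returns_later => [|s' st].
  have [X ind] := induced_exists m_gt0 (proj1 bA) (proj2 bA).
  by eexists; apply: initialize ind.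
have [X Es'] := reduce_step_inv st bA.
by have := balanced_step st bA; rewrite Es'; apply: running_returns.
Qed.

Lemma reduces_to_balanceable (A B : label_matrix m) :
  balanceable U A -> reduces_to U A B -> balanceable U B.
Proof.
rewrite /reduces_to /balanceable => bA.
suff step s s' : clos_refl_trans _ (@reduce_step R U m) s s' ->
  balanced_state s -> balanced_state s' by move/step; apply.
elim=> [s1 s2||s1 s2 s3 _ IH1 _ IH2]; [exact: balanced_step|by []|].
by move/IH1/IH2.
Qed.

Lemma surely_returns_reduces_to (A : label_matrix m) :
  surely_returns U (Start (labels A)) -> exists B, reduces_to U A B.
Proof.
rewrite /reduces_to; elim=> [n N|s [s' st] _ IH].
  by exists (LabelMatrix N); apply: rt_refl.
by have [B ?] := IH _ st; exists B; apply: rt_trans; first exact: rt_step st.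
Qed.

End Reduce.

(** * Feasible lengths for the matrix of the recursion *)

Section Concatenation.
Variables (R : realType) (V : seq R) (m n1 n2 : nat).
Variables (X1 : 'rV[R]_n1) (X2 : 'rV[R]_n2).
Variables (A : 'M[nat]_(m, n1)) (B : 'M[nat]_(m, n2)).

Lemma full_row_mx b : full b A -> full b B -> full b (row_mx A B).
Proof.
move=> fA fB j; have [k ->|k ->] := split_ordP j.
  rewrite (_ : (fun i => _) = A^~ k) //.
  by apply: funext => i; rewrite row_mxEl.
rewrite (_ : (fun i => _) = B^~ k) //.
by apply: funext => i; rewrite row_mxEr.
Qed.

Lemma time_row_mxl i j : (j <= n1)%N ->
  time V (row_mx X1 X2) (row_mx A B) i j = time V X1 A i j.
Proof.
move=> le_j; rewrite /time big_split_ord /= [X in _ + X]big1 ?addr0 => [|k]; last first.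
  by rewrite ltnNge (leq_trans le_j) ?leq_addr.
by apply: eq_bigr => k _; rewrite !row_mxEl.
Qed.

Lemma time_row_mxr i j :
  time V (row_mx X1 X2) (row_mx A B) i (n1 + j) = time V X1 A i n1 + time V X2 B i j.
Proof.
rewrite /time big_split_ord /=; congr (_ + _).
  apply: eq_big => [k|k _]; last by rewrite !row_mxEl.
  by rewrite ltn_ord (leq_trans (ltn_ord k)) ?leq_addr.
by apply: eq_big => [k|k _]; rewrite ?ltn_add2l ?row_mxEr.
Qed.

(** Each agent enters the second part at its own finishing time of the first, so handovers there are
    compared with these offsets. The second hypothesis treats the seam. *)
Lemma bike_on_time_row_mx :
    bike_on_time V X1 A ->
    (forall i i' (j' : 'I_n1) (j : 'I_n2), j'.+1 = n1 -> B i j = A i' j' ->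
       B i j <> 0%N -> time V X1 A i' n1 <= time V X1 A i n1) ->
    (forall i i' (j' j : 'I_n2), j = j'.+1 :> nat -> B i j = B i' j' ->
       B i j <> 0%N -> time V X1 A i' n1 + time V X2 B i' j <=
                       time V X1 A i n1 + time V X2 B i j) ->
  bike_on_time V (row_mx X1 X2) (row_mx A B).
Proof.
move=> oA oAB oB i i' j' j.
have [k' ->|k' ->] := split_ordP j'; have [k ->|k ->] := split_ordP j;
  rewrite ?row_mxEl ?row_mxEr /= => jj' eqM Mij.
- by rewrite !time_row_mxl 1?ltnW //; apply: oA eqM Mij.
- have k0 : k = 0%N :> nat by have := ltn_ord k'; lia.
  have k'1 : k'.+1 = n1 by rewrite -jj' k0 addn0.
  by rewrite k0 addn0 !time_row_mxl //; apply: oAB eqM Mij.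
- by have := ltn_ord k; lia.
- by rewrite !time_row_mxr; apply: oB eqM Mij; apply: (@addnI n1); rewrite addnS.
Qed.

End Concatenation.

(* Solution of w * x = 1; nonnegative because w is nonincreasing. *)
Lemma renewal_solution (R : realType) (w : nat -> R) :
    0 < w 0%N -> (forall i j, (i <= j)%N -> w j <= w i) -> forall n,
  exists x : nat -> R, (forall a, 0 <= x a) /\
    forall i, (i < n)%N -> \sum_(a < i.+1) w (i - a)%N * x a = 1.
Proof.
move=> w0 w_mono; elim=> [|n [x [x_ge0 xE]]]; first by exists (fun=> 0).
(* What the old entries contribute to equation n. It is at most 1 by comparison with equation n - 1,
   as w is nonincreasing; the new entry supplies the rest. *)
pose s := \sum_(a < n) w (n - a)%N * x a.
have s_le1 : s <= 1.
  rewrite /s; case: n xE {s} => [|n] xE; first by rewrite big_ord0.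
  rewrite -(xE n) //; apply: ler_sum => a _; apply: ler_wpM2r => //.
  by apply: w_mono; rewrite leq_sub2r.
exists (fun a => if a == n then (1 - s) / w 0%N else x a); split=> [a|i].
  by case: ifP => // _; apply: divr_ge0; rewrite ?subr_ge0 // ltW.
rewrite ltnS leq_eqVlt => /orP[/eqP->|lt_in].
  rewrite big_ord_recr /= eqxx subnn mulrCA divff ?gt_eqF // mulr1.
  rewrite -[RHS](subrK s) addrC; congr (_ + _).
  by apply: eq_bigr => a _; rewrite ltn_eqF.
rewrite -[RHS](xE i) //; apply: eq_bigr => a _; rewrite ltn_eqF //.
exact: leq_trans (ltn_ord a) lt_in.
Qed.

(** * Shift columns and blocks: timing and handovers *)

Section Block.
Variables (R : realType) (m b k : nat) (V : seq R).
Hypotheses (size_V : size V = k)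
  (V_mono : forall i j, (i <= j)%N -> nth 1 V i <= nth 1 V j)
  (V0_lt1 : nth 1 V 0%N < 1).

(** What handovers depend on, whatever DP[l] is: each bike above l has one fixed rider, and the
    first m_l agents share the others. *)
Definition block_column l (c : 'I_(m - b + k) -> nat) : Prop :=
  forall i : 'I__, if (i < m - b + l)%N then (c i <= l)%N else c i == (i.+1 - (m - b))%N.

(* For suitable lengths, not normalized to sum to 1, agents 1, ..., m_l meet at
   the end of A and the later agents arrive afterwards, in order; by the second
   clause this lets any block column take over the bikes. *)
Definition synchronized l (A : label_matrix (m - b + k)) : Prop :=
  [/\ full k A,
      forall (i i' : 'I__) (j : 'I_(width A)) c, j.+1 = width A -> block_column l c ->
        c i = labels A i' j -> c i <> 0%N -> (i' <= i)%N || (i' < m - b + l)%N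
    & exists X : 'rV[R]_(width A),
        [/\ forall j, 0 <= X 0 j, (0 < m - b + l)%N -> 0 < \sum_j X 0 j,
            bike_on_time V X (labels A)
          & forall i i' : 'I__, (i <= i')%N || (i < m - b + l)%N ->
              time V X (labels A) i (width A) <= time V X (labels A) i' (width A)]].

Lemma full_shift_columns : full k (labels (shift_columns m b k)).
Proof.
move=> j; split=> [i|i i'|l /andP[l0 lk]].
- by rewrite mxE; case: ifP => // /andP[]; lia.
- rewrite !mxE; case: ifP => // /andP[ji _] _; case: ifP => // /andP[ji' _] [e].
  by apply: val_inj => /=; lia.
- have lt_i : (j + l.-1 < m - b + k)%N by have := ltn_ord j; rewrite /=; lia.
  by exists (Ordinal lt_i); rewrite mxE /=; case: ifP; lia.
Qed.

Lemma synchronized_shift_columns : synchronized 0 (shift_columns m b k).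
Proof.
split; first exact: full_shift_columns.
  move=> i i' j c /= jp cP cij ci; move: (cP i) cij ci; rewrite addn0 mxE.
  case: ifP => [_|ip /eqP->]; first by rewrite leqn0 => /eqP->.
  by case: ifP => // /andP[]; move: jp (ltn_ord j); lia.
(* The default value 1 makes w vanish past the last bike, in agreement with walking. *)
pose w i := 1 - nth 1 V i.
have w_mono i j : (i <= j)%N -> w j <= w i by move=> ij; rewrite lerD2l lerN2 V_mono.
have [|x [x_ge0 xE]] := @renewal_solution R w _ w_mono (m - b); first by rewrite subr_gt0.
have timeE i c :
    time V (\row_a x a) (labels (shift_columns m b k)) i c =
    \sum_(a < m - b | (a < c)%N) x a -
    \sum_(a < m - b | (a < c)%N) (if (a <= i)%N then w (i - a)%N else 0) * x a.
  rewrite -sumrB; apply: eq_bigr => a _; rewrite !mxE /w -[X in X - _]mul1r -mulrBl.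
  congr (_ * _); case: (leqP a i) => /= [ai|_]; last by rewrite subr0.
  case: ltnP => [_|ik]; first by rewrite subKr.
  by rewrite nth_default ?subrr ?subr0 // size_V; lia.
exists (\row_a x a); split.
- by move=> j; rewrite mxE.
- rewrite addn0 => p_gt0; have := xE 0%N p_gt0.
  rewrite big_ord1 /= => x0; rewrite (bigD1 (Ordinal p_gt0)) //= mxE.
  apply: ltr_pwDl; last by apply: sumr_ge0 => a _; rewrite mxE.
  rewrite lt_def x_ge0 andbT; apply/eqP => z.
  by move: x0; rewrite z mulr0 => /eqP; rewrite eq_sym oner_eq0.
(* Equal nonzero labels in adjacent shift columns force i = i' + 1, so the savings compare term by
   term. *)
- rewrite /bike_on_time /= => i i' j' j jj'; rewrite !mxE.
  case: ifP => [/andP[ji ik]|//]; case: ifP => [/andP[ji' _]|//] [e] _.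
  rewrite !timeE lerD2l lerN2; apply: ler_sum => a aj.
  apply: ler_wpM2r => //; rewrite !ifT; try lia.
  by apply: w_mono; lia.
- move=> /= i i'; rewrite addn0 => ii'; rewrite !timeE lerD2l lerN2.
  (* W c is what agent c has saved at the end: 1 for the first m - b agents, nonincreasing from
     there on. *)
  pose W (c : nat) := \sum_(a < m - b) (if (a <= c)%N then w (c - a)%N else 0) * x a.
  have W1 c : (c < m - b)%N -> W c = 1.
    move=> cp; rewrite -(xE c cp) /W (big_ord_widen _ (fun a => w (c - a)%N * x a) cp).
    rewrite [RHS]big_mkcond; apply: eq_bigr => a _.
    by rewrite ltnS; case: ifP; rewrite ?mul0r.
  have WS c : W c.+1 <= W c.
    have [cp|pc] := ltnP c.+1 (m - b); first by rewrite !W1 // ltnW.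
    apply: ler_sum => a _; apply: ler_wpM2r => //.
    rewrite !ifT; try by move: (ltn_ord a); lia.
    by apply: w_mono; lia.
  have W_mono c d : W (c + d)%N <= W c.
    by elim: d => [|d IHd]; rewrite ?addn0 // addnS (le_trans (WS _)).
  have W_le : W i' <= W i.
    case/orP: ii' => [ii'|ip]; first by rewrite -(subnKC ii').
    by rewrite (W1 i) // -(W1 0%N) ?(leq_ltn_trans _ ip) // -[X in W X]add0n.
  under eq_bigl do rewrite ltn_ord.
  by under [leRHS]eq_bigl do rewrite ltn_ord.
Qed.

Lemma dp_block_in l (D : label_matrix (m - b + l))
    (i : 'I_(m - b + k)) (i' : 'I_(m - b + l)) c :
  i = i' :> nat -> labels (dp_block k D) i c = labels D i' c.
Proof. by move=> ii'; rewrite mxE ii' valK. Qed.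

Lemma dp_block_out l (D : label_matrix (m - b + l)) (i : 'I_(m - b + k)) c :
  (m - b + l <= i)%N -> labels (dp_block k D) i c = (i.+1 - (m - b))%N.
Proof. by move=> li; rewrite mxE insubN // -leqNgt. Qed.

Lemma block_column_dp_block l (D : label_matrix (m - b + l)) c :
  full l (labels D) -> block_column l ((labels (dp_block k D))^~ c).
Proof.
move=> fD i; case: ltnP => [il|li]; last by rewrite dp_block_out.
by rewrite (dp_block_in (i' := Ordinal il)) //; case: (fD c).
Qed.

(** Puts the columns on both sides of the seam between two successive blocks under one
    description. *)
Lemma block_columnS l c : block_column l c -> block_column l.+1 c.
Proof.
move=> cP i; have := cP i; case: ltnP => [il|li].
  by rewrite ifT; [exact: leqW|rewrite addnS ltnW].
by move/eqP->; case: ifP; lia.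
Qed.

(** Labels above l determine their row, and the nonzero labels up to l occur only in the first m_l
    rows. *)
Lemma block_column_handover l c c' (i i' : 'I_(m - b + k)) :
    block_column l c -> block_column l c' -> c i = c' i' -> c i <> 0%N ->
  i = i' \/ (i < m - b + l)%N /\ (i' < m - b + l)%N.
Proof.
move=> cP c'P ee; have := c'P i'; rewrite -ee; have := cP i.
case: ltnP => il; case: ltnP => i'l; try by [right | lia].
by move=> /eqP-> /eqP e _; left; apply: val_inj => /=; lia.
Qed.

Lemma full_dp_block l (D : label_matrix (m - b + l)) :
  (l <= k)%N -> full l (labels D) -> full k (labels (dp_block k D)).
Proof.
move=> lk fD c; have cP := block_column_dp_block c fD; have [le_l inj sur] := fD c.
split=> [i|i i' ci e|q /andP[q0 qk]].
- by have := cP i; case: ifP => _; [move/leq_trans; apply|move/eqP->; have := ltn_ord i; lia].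
- have [->//|[il i'l]] := block_column_handover cP cP (esym e) ci.
  move: ci e; rewrite (dp_block_in (i' := Ordinal il)) // (dp_block_in (i' := Ordinal i'l)) //.
  by move=> ci e; have /(congr1 val)/= := inj _ _ ci e; apply: val_inj.
- have [ql|lq] := leqP q l.
    have [|i Di] := sur q; first by rewrite q0 ql.
    have ik : (i < m - b + k)%N by apply: leq_trans (ltn_ord i) _; rewrite leq_add2l.
    by exists (Ordinal ik); rewrite (dp_block_in (i' := i)).
  have ik : (m - b + q.-1 < m - b + k)%N by lia.
  by exists (Ordinal ik); rewrite dp_block_out /=; lia.
Qed.

Lemma time_dp_block_in l (D : label_matrix (m - b + l)) (X : 'rV_(width D))
    (i : 'I_(m - b + k)) (i' : 'I_(m - b + l)) j :
    full l (labels D) -> i = i' :> nat ->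
  time V X (labels (dp_block k D)) i j = time (take l V) X (labels D) i' j.
Proof.
move=> fD ii'; apply: eq_bigr => c _; rewrite (dp_block_in (i' := i')) //; congr (_ * _).
have [+ _ _] := fD c => /(_ i'); case: (labels D i' c) => // q ql.
by rewrite /inverse_speed /= nth_take.
Qed.

Lemma time_dp_block_out l (D : label_matrix (m - b + l)) (X : 'rV_(width D))
    (i : 'I_(m - b + k)) :
    (m - b + l <= i)%N -> \sum_j X 0 j = 1 ->
  time V X (labels (dp_block k D)) i (width D) = nth 1 V (i - (m - b)).
Proof.
move=> li X1; rewrite -[RHS]mulr1 -[Y in _ = _ * Y]X1 mulr_sumr /time.
under eq_bigl do rewrite ltn_ord; apply: eq_bigr => c _.
by rewrite dp_block_out // subSn // (leq_trans _ li) // leq_addr.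
Qed.

(* The schedule so far is scaled by c and the new block by y, where e is agent
   m_l + 1.  If u = T she can never catch up, and c = 0 drops the schedule so
   far. *)
Lemma catch_up (t : 'I_(m - b + k) -> R) l (e : 'I_(m - b + k)) (T u s : R) :
    (forall i i' : 'I__, (i <= i')%N || (i < m - b + l)%N -> t i <= t i') ->
    ((0 < m - b + l)%N -> 0 < s) -> 0 <= s -> ((0 < m - b + l)%N -> u <= T) ->
  exists c y, [/\ 0 <= c, 0 <= y, 0 < c * s + y
    & forall i : 'I__, (i < m - b + l)%N -> c * t i + y * T = c * t e + y * u].
Proof.
(* If m = b and l = 0, there are no earlier agents to meet, and the schedule so far may have total
   length 0. *)
move=> t_mono s_gt0 s_ge0 uT; have [p0|p_gt0] := posnP (m - b + l)%N.
  by exists 0, 1; split=> //; [rewrite mul0r add0r|rewrite p0].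
have p_lt : (0 < m - b + k)%N by apply: leq_ltn_trans (ltn_ord e).
pose o : 'I_(m - b + k) := Ordinal p_lt.
have to (i : 'I__) : (i < m - b + l)%N -> t i = t o.
  by move=> il; apply/le_anti; rewrite !t_mono ?il ?orbT.
have [Tu|Tu] := eqVneq T u.
  exists 0, 1; split=> // [|i _]; first by rewrite mul0r add0r.
  by rewrite !mul0r Tu.
have uT' : 0 < T - u by rewrite subr_gt0 lt_def Tu uT.
have oe : t o <= t e by apply: t_mono.
(* A solution of [c * (t e - t o) = y * (T - u)], where [o] stands for the first m_l agents. *)
exists (T - u), (t e - t o); split; rewrite ?subr_ge0 ?uT //.
  by rewrite ltr_wpDr ?subr_ge0 // mulr_gt0 ?s_gt0.
by move=> i /to->; ring.
Qed.

(** Inside the block bikes change hands only among the first m_l agents, who enter it together, so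
    the order of handovers in DP[l] carries over. The later agents ride bikes of nondecreasing
    inverse speed, which preserves their order. *)
Lemma synchronized_step l A (D : label_matrix (m - b + l)) :
    (l < k)%N -> synchronized l A -> balanceable (take l V) D ->
    ((0 < m - b + l)%N -> nth 1 V l <= mean_inverse_speed (m - b + l) (take l V)) ->
  synchronized l.+1 (lm_cat A (dp_block k D)).
Proof.
move=> lk [fA hA [X1 [X1_ge0 X1_gt0 oX1 t_mono]]] [fD [X2 [[X2_ge0 X2_1] oX2 eT]]] uT.
rewrite size_takel ?size_V ?(ltnW lk) // in fD.
have cP c := block_column_dp_block c fD.
(* Ensures that the last column of the concatenation lies in the new block. *)
have n2_gt0 : (0 < width D)%N.
  rewrite lt0n; apply/eqP => n2; have := X2_1; rewrite big1 => [/eqP|j _].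
    by rewrite eq_sym oner_eq0.
  by have := ltn_ord j; rewrite {2}n2.
pose t i := time V X1 (labels A) i (width A).
have ek : (m - b + l < m - b + k)%N by rewrite ltn_add2l.
pose e := Ordinal ek.
have [|c [y [c_ge0 y_ge0 cy_gt0 sync]]] :=
  @catch_up t l e (mean_inverse_speed (m - b + l) (take l V)) (nth 1 V l)
    (\sum_j X1 0 j) t_mono X1_gt0 _ uT; first exact: sumr_ge0.
pose t' i := c * t i + y * time V X2 (labels (dp_block k D)) i (width D).
(* The inequality is not strict: row m - b + l is [e], which has just joined the synchronized
   agents. *)
have t'_in (i : 'I__) : (i <= m - b + l)%N -> t' i = t' e.
  rewrite leq_eqVlt => /orP[/eqP il|il]; first by congr t'; apply: val_inj.
  rewrite /t' (time_dp_block_out (i := e)) //= addKn -(sync i il).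
  by rewrite (@time_dp_block_in _ _ _ _ (Ordinal il)) // eT.
have t'_out (i i' : 'I__) : (m - b + l <= i)%N -> (i <= i')%N -> t' i <= t' i'.
  move=> li ii'; rewrite /t' !time_dp_block_out ?(leq_trans li) //.
  by rewrite lerD ?ler_wpM2l ?V_mono ?leq_sub2r // t_mono ?ii'.
split.
- by apply: full_row_mx => //; apply: full_dp_block fD; apply: ltnW.
- move=> i i' j d /= jE dP; have [q jq|q jq] := split_ordP j.
    by move: jE (ltn_ord q); rewrite jq /=; lia.
  rewrite jq row_mxEr => di d0.
  have [->|[_ ->]] := block_column_handover dP (block_columnS (cP q)) di d0.
    by rewrite leqnn.
  by rewrite orbT.
- exists (row_mx (c *: X1) (y *: X2)); split.
  + by move=> j; rewrite mxE; case: split => a; rewrite mxE mulr_ge0.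
  + move=> _; rewrite big_split_ord /=; under eq_bigr do rewrite row_mxEl mxE.
    under [X in _ + X]eq_bigr do rewrite row_mxEr mxE.
    by rewrite -!mulr_sumr X2_1 mulr1.
  + apply: bike_on_time_row_mx.
    * by move=> i i' j' j jj' eqM Mij; rewrite !timeZ ler_wpM2l //; apply: oX1 eqM Mij.
    * move=> i i' j' j j'E eqM Mij; rewrite !timeZ ler_wpM2l // t_mono //.
      exact: hA j'E (cP j) eqM Mij.
    * move=> i i' j' j jj' eqM Mij; rewrite !timeZ.
      have [->//|[il i'l]] := block_column_handover (cP j) (cP j') eqM Mij.
      rewrite lerD ?ler_wpM2l ?t_mono ?i'l ?orbT //.
      rewrite !(@time_dp_block_in _ _ _ i (Ordinal il)) //.
      rewrite !(@time_dp_block_in _ _ _ i' (Ordinal i'l)) //.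
      move: eqM Mij; rewrite !(@dp_block_in _ _ i (Ordinal il)) //.
      rewrite !(@dp_block_in _ _ i' (Ordinal i'l)) //.
      exact: oX2.
  + move=> i i' ii'; rewrite /= !time_row_mxr !timeZ -/(t' i) -/(t' i').
    have [il|li] := leqP i (m - b + l).
      rewrite (t'_in i) //; have [i'l|li'] := leqP i' (m - b + l); first by rewrite (t'_in i').
      by apply: t'_out => //; apply: ltnW.
    by apply: t'_out; [exact: ltnW|move: ii'; rewrite addnS ltnS [(i <= _ + l)%N]leqNgt li orbF].
Qed.

(** After k blocks all m_k agents are synchronized; it remains to rescale the lengths to sum 1. *)
Lemma balanceable_dp_matrix (D : forall l, label_matrix (m - b + l)) :
    (0 < k)%N -> (forall l, (l < k)%N -> balanceable (take l V) (D l)) ->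
    (forall l, (l < k)%N -> (0 < m - b + l)%N ->
       nth 1 V l <= mean_inverse_speed (m - b + l) (take l V)) ->
  balanceable V (dp_matrix k D).
Proof.
move=> k_gt0 bD uT.
have mk_gt0 : (0 < m - b + k)%N by rewrite addn_gt0 k_gt0 orbT.
suff [fM _ [X [X_ge0 X_gt0 oX t_mono]]] : synchronized k (dp_matrix k D).
  have {}fM : full (size V) (labels (dp_matrix k D)) by rewrite size_V.
  split=> //; have s_gt0 := X_gt0 mk_gt0.
  pose s := \sum_j X 0 j; exists (s^-1 *: X).
  have pX : partition_vector (s^-1 *: X).
    split=> [j|]; first by rewrite mxE mulr_ge0 // invr_ge0 ltW.
    by under eq_bigr do rewrite mxE; rewrite -mulr_sumr mulVf // gt_eqF.
  have oX' : bike_on_time V (s^-1 *: X) (labels (dp_matrix k D)).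
    move=> i i' j' j jj' eqM Mij; rewrite !timeZ ler_wpM2l ?invr_ge0 ?(ltW s_gt0) //.
    exact: oX eqM Mij.
  (* Each time is at most every other one, hence at most their average T. *)
  apply: balanced_of_le => // i.
  rewrite -(ler_pM2l (_ : 0 < (m - b + k)%:R)) ?ltr0n //.
  have := sum_time_full (s^-1 *: X) mk_gt0 fM; rewrite (proj2 pX) mulr1 => <-.
  rewrite mulr_natl -[X in _ *+ X](card_ord (m - b + k)) -sumr_const.
  apply: ler_sum => i' _; rewrite !timeZ ler_wpM2l ?invr_ge0 ?(ltW s_gt0) //.
  by rewrite t_mono // ltn_ord orbT.
rewrite /dp_matrix; suff: forall l, (l <= k)%N -> synchronized l
    (foldl (fun A l => lm_cat A (dp_block k (D l))) (shift_columns m b k) (iota 0 l)).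
  by apply.
elim=> [|l IHl] lk; first exact: synchronized_shift_columns.
rewrite -addn1 iotaD foldl_cat /= addn1; apply: synchronized_step => //.
- exact/IHl/ltnW.
- exact: bD.
- exact: uT.
Qed.

End Block.

(** * Runs of the algorithm *)

Section Run.
Variables (R : realType) (m b : nat) (U : seq R).
Hypotheses (b_gt0 : (0 < b)%N) (le_bm : (b <= m)%N) (size_U : size U = b)
  (U_mono : forall i j, (i <= j)%N -> nth 1 U i <= nth 1 U j)
  (U_bounds : forall i, (i < b)%N -> 0 < nth 1 U i < 1)
  (U_last : nth 1 U b.-1 <= mean_inverse_speed m U).

(** With u the inverse speed of bike l + 1, the claim amounts to $\sum_{j\le
    l}(u-u_j)\le(m-b)(1-u)$, where m - b does not depend on l. Going down from the last bike, the
    left side does not grow and the right side does not shrink. *)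
Lemma next_bike_speed_le l : (l < b)%N -> (0 < m - b + l)%N ->
  nth 1 U l <= mean_inverse_speed (m - b + l) (take l U).
Proof.
move=> lb ml_gt0; have m_gt0 : (0 < m)%N by apply: leq_trans le_bm.
rewrite -(ler_pM2l (_ : 0 < (m - b + l)%:R)) ?ltr0n // mean_inverse_speedE //.
have: m%:R * nth 1 U b.-1 <= m%:R * mean_inverse_speed m U.
  by rewrite ler_pM2l ?ltr0n.
rewrite mean_inverse_speedE // size_takel ?size_U ?(ltnW lb) // -{1 2}(subnK le_bm) !natrD.
under [X in _ -> _ <= _ - X]eq_bigr => j _ do rewrite nth_take ?ltn_ord //.
set p := (m - b)%:R : R; set v := nth 1 U b.-1; set u := nth 1 U l => hv.
have le_uv : u <= v by apply: U_mono; lia.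
have p_ge0 : 0 <= p by rewrite ler0n.
have sumE n (c : R) : \sum_(j < n) (c - nth 1 U j) =
    \sum_(j < n) (1 - nth 1 U j) - n%:R * (1 - c).
  rewrite -[X in X%:R]card_ord mulr_natl -sumr_const -sumrB; apply: eq_bigr => j _.
  by ring.
have le1 : \sum_(j < l) (u - nth 1 U j) <= \sum_(j < l) (v - nth 1 U j).
  by apply: ler_sum => j _; rewrite lerD2r.
have le2 : \sum_(j < l) (v - nth 1 U j) <= \sum_(j < b) (v - nth 1 U j).
  rewrite (big_ord_widen b (fun j => v - nth 1 U j) (ltnW lb)) big_mkcond.
  apply: ler_sum => j _; case: ifP => // _.
  by rewrite subr_ge0 U_mono //; have := ltn_ord j; lia.
have := mulr_ge0 p_ge0 (_ : 0 <= v - u); rewrite subr_ge0 => /(_ le_uv).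
move: le1 le2; rewrite (sumE _ u) !(sumE _ v); lra.
Qed.

Lemma dp_step_balanceable k (D : forall l, label_matrix (m - b + l)) :
    (0 < k <= b)%N -> (forall l, (l < k)%N -> balanceable (take l U) (D l)) ->
  balanceable (take k U) (dp_matrix k D).
Proof.
case/andP=> k_gt0 kb bD.
have nth_le1 i : nth 1 U i <= 1.
  have [ib|bi] := ltnP i b; first by case/andP: (U_bounds ib) => _ /ltW.
  by rewrite nth_default // size_U.
apply: balanceable_dp_matrix => // [|i j ij||l lk|l lk ml].
- by rewrite size_takel // size_U.
(* Past the end of the truncated list the value is 1, an upper bound for all entries. *)
- have [jk|kj] := ltnP j k; first by rewrite !nth_take ?(leq_ltn_trans ij) ?U_mono.
  rewrite [leRHS]nth_default ?size_takel ?size_U //.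
  have [ik|ki] := ltnP i k; first by rewrite nth_take.
  by rewrite nth_default ?size_takel ?size_U.
- by rewrite nth_take //; case/andP: (U_bounds b_gt0).
- by rewrite take_takel ?(ltnW lk) //; apply: bD.
- rewrite nth_take // take_takel ?(ltnW lk) //.
  by apply: next_bike_speed_le; rewrite // (leq_trans lk).
Qed.

Lemma balanceable_zero_column n :
  balanceable ([::] : seq R) (LabelMatrix (const_mx 0%N : 'M[nat]_(n, 1))).
Proof.
split=> [j|]; first by split=> [i|i i'|k]; rewrite ?mxE //; case: k.
exists (const_mx 1 : 'rV[R]_1); split.
- by split=> [j|]; rewrite ?big_ord1 mxE.
- by move=> i i' j' j; rewrite !ord1.
- move=> i; rewrite /time big_mkcond big_ord1 !mxE mulr1.
  by rewrite /mean_inverse_speed big_nil mulr0 subr0.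
Qed.

Lemma dp_run_balanceable k (D : forall l, label_matrix (m - b + l)) :
  (k <= b)%N -> dp_run U k D ->
  forall l, (l <= k)%N -> balanceable (take l U) (D l).
Proof.
move=> kb [D0 runD]; elim/ltn_ind=> -[_ _|l IHl lk].
  by rewrite take0 D0; apply: balanceable_zero_column.
have ml_gt0 : (0 < m - b + l.+1)%N by rewrite addnS.
apply: (reduces_to_balanceable ml_gt0 _ (runD l.+1 lk)).
apply: dp_step_balanceable => [|l' l'l]; first by rewrite (leq_trans lk).
by apply: IHl => //; apply: leq_trans lk; apply: ltnW.
Qed.

Lemma dp_run_step_balanceable k (D : forall l, label_matrix (m - b + l)) :
  (k < b)%N -> dp_run U k D -> balanceable (take k.+1 U) (dp_matrix k.+1 D).
Proof.
move=> kb runD; apply: dp_step_balanceable => // l.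
exact: dp_run_balanceable (ltnW kb) runD l.
Qed.

Lemma dp_run_full (D : forall l, label_matrix (m - b + l)) :
  dp_run U b D -> balanceable U (D b).
Proof.
by move=> /(dp_run_balanceable (leqnn b))/(_ _ (leqnn b)); rewrite -{1}size_U take_size.
Qed.

Lemma eq_dp_matrix k (D D' : forall l, label_matrix (m - b + l)) :
  (forall l, (l < k)%N -> D l = D' l) -> dp_matrix k D = dp_matrix k D'.
Proof.
move=> eqD; rewrite /dp_matrix; have: {subset iota 0 k <= gtn k}.
  by move=> l; rewrite mem_iota.
elim: (iota 0 k) (shift_columns _ _ _) => //= l s IHs A sub.
rewrite eqD ?IHs //; first by move=> x xs; apply: sub; rewrite inE xs orbT.
by apply: sub; rewrite inE eqxx.
Qed.

Lemma dp_run_exists k : (k <= b)%N ->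
  exists D : forall l, label_matrix (m - b + l), dp_run U k D.
Proof.
elim: k => [_|k IHk kb].
  by exists (fun l => LabelMatrix (const_mx 0%N : 'M[nat]_(_, 1))); split=> // -[].
have [D runD] := IHk (ltnW kb).
have mk_gt0 : (0 < m - b + k.+1)%N by rewrite addnS.
have [B redB] := surely_returns_reduces_to
  (reduce_surely_returns mk_gt0 (dp_run_step_balanceable kb runD)).
(* [D'] replaces entry k + 1 of [D] by [B]; the matrices up to index k + 1 read only smaller
   entries. *)
pose D' := dfwith D B; exists D'.
have D'E l : (l <= k)%N -> D' l = D l.
  by move=> lk; rewrite /D' dfwith_out // gtn_eqF.
have D'M l : (l <= k.+1)%N -> dp_matrix l D' = dp_matrix l D.
  by move=> lk; apply: eq_dp_matrix => l' l'l; apply: D'E; rewrite -ltnS (leq_trans l'l).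
have [D0 redD] := runD; split=> [|l /andP[l0]]; first by rewrite D'E.
rewrite leq_eqVlt => /orP[/eqP->|lk]; first by rewrite D'M // /D' dfwith_in.
by rewrite D'M ?D'E //; [apply: redD; rewrite l0|exact: leqW].
Qed.

End Run.

Lemma balanceable_cast (R : realType) (U : seq R) m0 m (e : m0 = m) (A : label_matrix m0) :
  balanceable U A ->
  balanceable U (LabelMatrix (castmx (e, erefl (width A)) (labels A))).
Proof. by case: _ / e => bA; rewrite castmx_id; case: A bA. Qed.

Theorem theorem11 (R : realType) (m b : nat) (hb : (1 <= b)%N) (hbm : (b <= m)%N)
    (U : b.-tuple R)
    (hsorted : forall k l : 'I_b, (k <= l)%N -> tnth U k <= tnth U l)
    (hU : forall k : 'I_b, 0 < tnth U k < 1)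
    (hT : forall k : 'I_b, k = b.-1 :> nat -> tnth U k <= mean_inverse_speed m U) :
  [/\ allmakeit_terminates m b U,
      exists (n : nat) (X : 'rV[R]_n) (M : 'M[nat]_(m, n)),
        allmakeit_output hbm U X M
    & forall (n : nat) (X : 'rV[R]_n) (M : 'M[nat]_(m, n)),
        allmakeit_output hbm U X M -> solves_relaxed_bike_sharing U X M].
Proof.
have m_gt0 : (0 < m)%N by apply: leq_trans hbm.
have sU : size U = b by rewrite size_tuple.
have nthU (k : 'I_b) : nth 1 U k = tnth U k by rewrite (tnth_nth 1).
have U_bounds i : (i < b)%N -> 0 < nth 1 U i < 1.
  by move=> ib; rewrite (nthU (Ordinal ib)).
(* The default value 1 keeps the sequence nondecreasing past its end. *)
have U_mono i j : (i <= j)%N -> nth 1 U i <= nth 1 U j.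
  move=> ij; have [jb|bj] := ltnP j b.
    by rewrite (nthU (Ordinal (leq_ltn_trans ij jb))) (nthU (Ordinal jb)) hsorted.
  rewrite [leRHS]nth_default ?sU //; have [ib|bi] := ltnP i b.
    by case/andP: (U_bounds i ib) => _ /ltW.
  by rewrite nth_default ?sU.
have U_last : nth 1 U b.-1 <= mean_inverse_speed m U.
  have bb : (b.-1 < b)%N by rewrite prednK.
  by rewrite (nthU (Ordinal bb)) hT.
have speed01 k : 0 <= inverse_speed U k <= 1.
  case: k => [|k]; rewrite /inverse_speed /= ?ler01 ?lexx //.
  have [kb|bk] := ltnP k b; last by rewrite nth_default ?sU ?ler01 ?lexx.
  by case/andP: (U_bounds k kb) => /ltW-> /ltW->.
have runE D := @dp_run_full R m b U hb hbm sU U_mono U_bounds U_last D.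
have mb_gt0 : (0 < m - b + b)%N by rewrite subnK.
split.
- split=> [k D kb runD|D /runE[fM bM]]; last exact: induced_exists.
  apply: reduce_surely_returns; first by rewrite addnS.
  exact: dp_run_step_balanceable.
- have [D runD] := dp_run_exists hb hbm sU U_mono U_bounds U_last (leqnn b).
  have [fM bM] := balanceable_cast (subnK hbm) (runE D runD).
  have [X indX] := induced_exists m_gt0 fM bM.
  by exists (width (D b)), X, (castmx (subnK hbm, erefl _) (labels (D b))), D.
- move=> n X M [D [runD eM indX]].
  have [fM bM] : balanceable U (LabelMatrix M).
    by rewrite eM; apply/balanceable_cast/runE.
  by apply: balanced_optimal => //; apply: induced_balanced indX.
Qed.
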